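(* Let $I\subset\mathbb{R}$ be an interval with $0\in I$, let $l:I\to\mathbb{R}$ be a $C^\infty$ function such that $P=l^{-1}(0)$ is a discrete set, and let $H:I\setminus P\to\mathbb{R}$ be a $C^\infty$ function such that $Hl$ extends to a $C^\infty$ function on $I$. Put $$\eta(u)=\int_0^u 2l(v)H(v)\,dv,\quad F(t)=\int_0^t l(u)\sin\eta(u)\,du,\quad G(t)=\int_0^t l(u)\cos\eta(u)\,du .$$ Consider $C^\infty$ functions $x,y,\phi:I\to\mathbb{R}$ with $y>0$ satisfying $$2H(t)y(t)l(t)-l(t)\cos\phi(t)+y(t)\phi'(t)=0,\qquad (x'(t),y'(t))=l(t)(\cos\phi(t),\sin\phi(t))\qquad(t\in I).$$ (i) If $x,y,\phi$ satisfy these equations, then there are $c_1,c_2\in\mathbb{R}$ such that for all $t\in I$ $$y(t)=\big((F(t)-c_1)^2+(G(t)-c_2)^2\big)^{1/2},\qquad x'(t)=\frac{F'(t)(G(t)-c_2)-G'(t)(F(t)-c_1)}{\big((F(t)-c_1)^2+(G(t)-c_2)^2\big)^{1/2}} .$$ (ii) Conversely, if $c_1,c_2\in\mathbb{R}$ satisfy $(F(t)-c_1)^2+(G(t)-c_2)^2>0$ for all $t\in I$ and $(x,y)$ is given by the two formulas in (i), then there is a $C^\infty$ function $\phi:I\to\mathbb{R}$ such that $x,y,\phi$ satisfy the equations above. In particular, the surface of revolution $s(t,\theta)=(x(t),y(t)\cos\theta,y(t)\sin\theta)$ has mean curvature $H(t)$ for $t\in I\setminus P$ with respect to the unit normal 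$\nu(t,\theta)=(\sin\phi(t),-\cos\phi(t)\cos\theta,-\cos\phi(t)\sin\theta)$.
   Context: Here $Hl$ (and the integrand $2lH$ in $\eta$, and the term $2Hyl$) is understood via the $C^\infty$ extension to $I$. The mean curvature with respect to the unit normal $\nu$ is half the trace of the shape operator $-d\nu$ (so that a cylinder with $\phi=0$, $y$ constant has mean curvature $1/(2y)$); for a curve with $(x',y')=l(\cos\phi,\sin\phi)$ and $y>0$ it equals $\frac12\left(\frac{\cos\phi}{y}-\frac{\phi'}{l}\right)$ where $l\neq0$. *)

(* Defs.v *)
From Stdlib Require Import Reals.
From Coquelicot Require Import Coquelicot.
Open Scope R_scope.

(* A real function on a subset D of R is represented by a total function of
   which only the values on D matter. *)

(* Derivative relative to D: the difference quotient is taken along points of D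
   only, so it is one-sided at an endpoint of an interval D.  It is only
   meaningful (unique) when t lies in D and is not isolated in D. *)
Definition is_derive_within {V : NormedModule R_AbsRing}
    (D : R -> Prop) (f : R -> V) (t : R) (d : V) : Prop :=
  filterdiff f (within D (locally t)) (fun h : R => scal h d).

Definition derivative_on (D : R -> Prop) (f f' : R -> R) : Prop :=
  forall t, D t -> is_derive_within D f t (f' t).

(* C^infinity on D: fn n is the n-th derivative of f. *)
Definition smooth_on (D : R -> Prop) (f : R -> R) : Prop :=
  exists fn : nat -> R -> R,
    (forall t, D t -> fn O t = f t) /\
    (forall n, derivative_on D (fn n) (fn (S n))).

(* Intervals of any kind (open, closed, half-open, bounded or not) with more
   than one point. *)
Definition is_interval (I : R -> Prop) : Prop :=
  (forall a b c, I a -> I b -> a <= c <= b -> I c) /\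
  (exists a b, I a /\ I b /\ a < b).

Definition is_discrete (P : R -> Prop) : Prop :=
  forall p, P p ->
    exists eps : posreal, forall q, P q -> Rabs (q - p) < eps -> q = p.

(* In the definitions below, Hl stands for the smooth extension to I of the
   product of H and l. *)

Definition eta (Hl : R -> R) (u : R) : R := RInt (fun v => 2 * Hl v) 0 u.

Definition F (l Hl : R -> R) (t : R) : R :=
  RInt (fun u => l u * sin (eta Hl u)) 0 t.

Definition G (l Hl : R -> R) (t : R) : R :=
  RInt (fun u => l u * cos (eta Hl u)) 0 t.

Definition radicand (l Hl : R -> R) (c1 c2 t : R) : R :=
  (F l Hl t - c1) ^ 2 + (G l Hl t - c2) ^ 2.

Definition is_solution (I : R -> Prop) (l Hl x y phi : R -> R) : Prop :=
  smooth_on I x /\ smooth_on I y /\ smooth_on I phi /\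
  (forall t, I t -> 0 < y t) /\
  exists x' y' phi' : R -> R,
    derivative_on I x x' /\ derivative_on I y y' /\ derivative_on I phi phi' /\
    forall t, I t ->
      2 * Hl t * y t - l t * cos (phi t) + y t * phi' t = 0 /\
      x' t = l t * cos (phi t) /\
      y' t = l t * sin (phi t).

Definition given_by_formulas
    (I : R -> Prop) (l Hl : R -> R) (c1 c2 : R) (x y : R -> R) : Prop :=
  (forall t, I t -> y t = sqrt (radicand l Hl c1 c2 t)) /\
  exists x' F' G' : R -> R,
    derivative_on I x x' /\
    derivative_on I (F l Hl) F' /\ derivative_on I (G l Hl) G' /\
    forall t, I t ->
      x' t = (F' t * (G l Hl t - c2) - G' t * (F l Hl t - c1))
             / sqrt (radicand l Hl c1 c2 t).

Definition dot (v w : R * R * R) : R :=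
  match v, w with
  | (v1, v2, v3), (w1, w2, w3) => v1 * w1 + v2 * w2 + v3 * w3
  end.

Definition revolution_surface (x y : R -> R) (t theta : R) : R * R * R :=
  (x t, y t * cos theta, y t * sin theta).

Definition revolution_normal (phi : R -> R) (t theta : R) : R * R * R :=
  (sin (phi t), - cos (phi t) * cos theta, - cos (phi t) * sin theta).

(* s, parametrized by I x R, is immersed at (t, theta), nu is a unit normal
   there, and k is half the trace of the shape operator - d nu; the latter is
   described by its matrix a11, a12, a21, a22 in the basis s_t, s_theta of the
   tangent plane. *)
Definition is_mean_curvature
    (I : R -> Prop) (s nu : R -> R -> R * R * R) (t theta k : R) : Prop :=
  exists s_t s_theta nu_t nu_theta : R * R * R,
    is_derive_within I (fun u => s u theta) t s_t /\
    is_derive (fun w => s t w) theta s_theta /\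
    is_derive_within I (fun u => nu u theta) t nu_t /\
    is_derive (fun w => nu t w) theta nu_theta /\
    (forall a b : R, plus (scal a s_t) (scal b s_theta) = zero -> a = 0 /\ b = 0) /\
    dot (nu t theta) (nu t theta) = 1 /\
    dot (nu t theta) s_t = 0 /\
    dot (nu t theta) s_theta = 0 /\
    exists a11 a12 a21 a22 : R,
      opp nu_t = plus (scal a11 s_t) (scal a21 s_theta) /\
      opp nu_theta = plus (scal a12 s_t) (scal a22 s_theta) /\
      k = / 2 * (a11 + a22).

(* Main.v *)
Require Import Defs.
From Stdlib Require Import Reals Lra ClassicalEpsilon.
From Coquelicot Require Import Coquelicot.
Open Scope R_scope.

(* Put [psi = phi + eta].  Since [eta' = 2 H l], the curvature equation reads
   [y psi' = l cos phi]; together with [y' = l sin phi] this gives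
   [(y e^(i psi))' = i l e^(i eta) = - F' + i G'], so that
   [y e^(i psi) = - (F - c1) + i (G - c2)] for some constants.  Taking moduli gives
   [y], and [x' = l cos (psi - eta)] gives [x'].  Conversely, the nowhere vanishing
   curve [- (F - c1) + i (G - c2)] has a smooth polar angle [psi] (the integral of
   its angular velocity), and [phi = psi - eta] solves the equations.  The tangent
   vectors [s_t] and [s_theta] are principal directions, with curvatures
   [- phi' / l] and [cos phi / y]. *)

(** * Calculus relative to a set *)

(** Neighbourhoods here are not punctured, so [t] itself witnesses that none is empty and [t] may
    even be isolated in [D]. *)
Lemma within_locally_proper (D : R -> Prop) (t : R) :
  D t -> ProperFilter (within D (locally t)).
Proof.
  intros Dt; split.
  - intros P [eps HP]; exists t; apply HP; [apply ball_center | exact Dt].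
  - apply within_filter, locally_filter.
Qed.

Lemma within_locally_lim (D : R -> Prop) (t : R) :
  is_filter_lim (within D (locally t)) t.
Proof. exact (filter_le_within D). Qed.

(** [filterdiff] asks for its estimate at every limit of the filter; by uniqueness of limits in a
    Hausdorff space only [t] has to be treated. *)
Lemma within_locally_lim_unique (D : R -> Prop) (t x : R) :
  D t -> is_filter_lim (within D (locally t)) x -> x = t.
Proof.
  intros Dt lim_x.
  apply (@is_filter_lim_unique R_AbsRing R_NormedModule (within D (locally t))
           (Proper_StrongProper _ (within_locally_proper D t Dt)) x t lim_x).
  apply within_locally_lim.
Qed.

Lemma is_derive_withinP (D : R -> Prop) (f : R -> R) (t d : R) : D t ->
  is_derive_within D f t d <->
  forall eps : posreal, exists delta : posreal, forall u, D u ->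
    Rabs (u - t) < delta ->
    Rabs (f u - f t - (u - t) * d) <= eps * Rabs (u - t).
Proof.
  intros Dt; split.
  - intros [_ df] eps.
    destruct (df t (within_locally_lim D t) eps) as [delta Hdelta].
    exists delta; intros u Du u_near.
    exact (Hdelta u u_near Du).
  - intros df; split; [apply (is_linear_scal_l (K := R_AbsRing) (V := R_NormedModule))|].
    intros x lim_x eps.
    rewrite (within_locally_lim_unique D t x Dt lim_x).
    destruct (df eps) as [delta Hdelta].
    exists delta; intros u u_near Du.
    exact (Hdelta u Du u_near).
Qed.

Lemma is_derive_within_ext (D : R -> Prop) (f g : R -> R) (t d : R) :
  D t -> (forall u, D u -> f u = g u) ->
  is_derive_within D f t d -> is_derive_within D g t d.
Proof.
  intros Dt fg df; unfold is_derive_within.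
  apply filterdiff_ext_loc with f; [| |exact df].
  - exists (mkposreal 1 Rlt_0_1); intros u _ Du; now apply fg.
  - intros x lim_x; rewrite (within_locally_lim_unique D t x Dt lim_x); now apply fg.
Qed.

Lemma is_derive_within_eq (D : R -> Prop) (f : R -> R) (t d d' : R) :
  d = d' -> is_derive_within D f t d -> is_derive_within D f t d'.
Proof. now intros ->. Qed.

Lemma is_derive_within_const (D : R -> Prop) (a t : R) :
  is_derive_within D (fun _ => a) t 0.
Proof.
  unfold is_derive_within; apply filterdiff_ext_lin with (fun _ => 0).
  - exact (filterdiff_const (V := R_NormedModule) a).
  - intros h; symmetry; exact (Rmult_0_r h).
Qed.

Lemma is_derive_within_plus (D : R -> Prop) (f g : R -> R) (t df dg : R) :
  is_derive_within D f t df -> is_derive_within D g t dg ->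
  is_derive_within D (fun u => f u + g u) t (df + dg).
Proof.
  intros Df Dg; unfold is_derive_within.
  eapply filterdiff_ext_lin.
  - exact (filterdiff_plus_fct f g _ _ Df Dg).
  - intros h; symmetry; exact (Rmult_plus_distr_l h df dg).
Qed.

Lemma is_derive_within_continuous (D : R -> Prop) (f : R -> R) (t d : R) :
  is_derive_within D f t d ->
  filterlim f (within D (locally t)) (locally (f t)).
Proof.
  intros df.
  apply (@filterdiff_continuous_aux R_AbsRing R_NormedModule R_NormedModule
           (within D (locally t)) (within_filter _ _ _ _) f).
  - eexists; exact df.
  - apply within_locally_lim.
Qed.

(** Continuity of [f] along the relative filter makes the image filter finer than [locally (f t)],
    so the ordinary derivative of [g] can be used along it. *)
Lemma is_derive_within_comp (D : R -> Prop) (f g : R -> R) (t df dg : R) :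
  D t -> is_derive_within D f t df -> is_derive g (f t) dg ->
  is_derive_within D (fun u => g (f u)) t (df * dg).
Proof.
  intros Dt Df Dg; unfold is_derive_within.
  pose proof (within_locally_proper D t Dt) as PF.
  eapply filterdiff_ext_lin.
  - apply (@filterdiff_comp R_AbsRing R_NormedModule R_NormedModule R_NormedModule
             (within D (locally t)) _ f g (fun h => scal h df) (fun h => scal h dg));
      [exact Df|].
    apply (@filterdiff_locally R_AbsRing R_NormedModule R_NormedModule
             (filtermap f (within D (locally t)))
             (filtermap_proper_filter _ _ _ _ PF) g (f t)).
    + exact (is_derive_within_continuous D f t df Df).
    + exact Dg.
  - intros h; unfold scal; simpl; unfold mult; simpl; ring.
Qed.

Lemma is_derive_within_opp (D : R -> Prop) (f : R -> R) (t df : R) :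
  D t -> is_derive_within D f t df -> is_derive_within D (fun u => - f u) t (- df).
Proof.
  intros Dt Df; replace (- df) with (df * -1) by ring.
  apply (is_derive_within_comp D f (fun z => - z) t df (-1) Dt Df).
  auto_derive; [trivial | ring].
Qed.

Lemma is_derive_within_minus (D : R -> Prop) (f g : R -> R) (t df dg : R) :
  D t -> is_derive_within D f t df -> is_derive_within D g t dg ->
  is_derive_within D (fun u => f u - g u) t (df - dg).
Proof.
  intros Dt Df Dg.
  apply (is_derive_within_plus D f (fun u => - g u) t df (- dg) Df).
  now apply is_derive_within_opp.
Qed.

(* The product rule follows from the chain rule by polarization,
   [f * g = (f + g)^2 / 2 - f^2 / 2 - g^2 / 2]. *)
Lemma is_derive_within_mult (D : R -> Prop) (f g : R -> R) (t df dg : R) :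
  D t -> is_derive_within D f t df -> is_derive_within D g t dg ->
  is_derive_within D (fun u => f u * g u) t (df * g t + f t * dg).
Proof.
  intros Dt Df Dg.
  assert (half_square : forall (h : R -> R) dh, is_derive_within D h t dh ->
            is_derive_within D (fun u => h u ^ 2 / 2) t (dh * h t)).
  { intros h dh Dh.
    apply (is_derive_within_comp D h (fun z => z ^ 2 / 2) t dh (h t) Dt Dh).
    auto_derive; [trivial | field]. }
  apply is_derive_within_ext
    with (fun u => (f u + g u) ^ 2 / 2 - f u ^ 2 / 2 - g u ^ 2 / 2); [exact Dt| |].
  { intros u _; simpl; field. }
  replace (df * g t + f t * dg)
    with ((df + dg) * (f t + g t) - df * f t - dg * g t) by ring.
  apply is_derive_within_minus; [exact Dt| |now apply half_square].
  apply is_derive_within_minus; [exact Dt| |now apply half_square].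
  apply half_square; exact (is_derive_within_plus D f g t df dg Df Dg).
Qed.

Lemma is_derive_within_div (D : R -> Prop) (f g : R -> R) (t df dg : R) :
  D t -> g t <> 0 -> is_derive_within D f t df -> is_derive_within D g t dg ->
  is_derive_within D (fun u => f u / g u) t ((df * g t - f t * dg) / g t ^ 2).
Proof.
  intros Dt gt Df Dg.
  replace ((df * g t - f t * dg) / g t ^ 2)
    with (df * / g t + f t * (dg * - / g t ^ 2)) by (field; exact gt).
  apply (is_derive_within_mult D f (fun u => / g u) t); [exact Dt|exact Df|].
  apply (is_derive_within_comp D g Rinv t dg); [exact Dt|exact Dg|].
  auto_derive; [exact gt | field; exact gt].
Qed.

Lemma is_derive_within_sin (D : R -> Prop) (f : R -> R) (t df : R) :
  D t -> is_derive_within D f t df ->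
  is_derive_within D (fun u => sin (f u)) t (df * cos (f t)).
Proof.
  intros Dt Df; apply is_derive_within_comp; [exact Dt|exact Df|apply is_derive_sin].
Qed.

Lemma is_derive_within_cos (D : R -> Prop) (f : R -> R) (t df : R) :
  D t -> is_derive_within D f t df ->
  is_derive_within D (fun u => cos (f u)) t (df * - sin (f t)).
Proof.
  intros Dt Df; apply is_derive_within_comp; [exact Dt|exact Df|apply is_derive_cos].
Qed.

Lemma is_derive_within_sqrt (D : R -> Prop) (f : R -> R) (t df : R) :
  D t -> 0 < f t -> is_derive_within D f t df ->
  is_derive_within D (fun u => sqrt (f u)) t (df / (2 * sqrt (f t))).
Proof.
  intros Dt ft Df.
  replace (df / (2 * sqrt (f t))) with (df * (1 / (2 * sqrt (f t))))
    by (field; apply Rgt_not_eq, sqrt_lt_R0, ft).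
  apply is_derive_within_comp; [exact Dt|exact Df|].
  apply (is_derive_sqrt (fun z => z) (f t) 1); [apply (is_derive_id (f t)) | exact ft].
Qed.

(** Near an interior point the restriction to [D] is vacuous. This gives the two-sided derivatives
    that the mean value theorem needs. *)
Lemma is_derive_within_locally (D : R -> Prop) (f : R -> R) (t d : R) :
  locally t D -> is_derive_within D f t d -> is_derive f t d.
Proof.
  intros D_near df.
  assert (Dt : D t) by exact (locally_singleton t D D_near).
  split; [apply (is_linear_scal_l (K := R_AbsRing) (V := R_NormedModule))|].
  intros x lim_x eps.
  rewrite <- (is_filter_lim_locally_unique t x lim_x).
  destruct D_near as [delta1 H1].
  destruct (proj1 (is_derive_withinP D f t d Dt) df eps) as [delta2 H2].
  assert (Hd : 0 < Rmin delta1 delta2)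
    by (apply Rmin_glb_lt; apply cond_pos).
  exists (mkposreal _ Hd); intros u u_near.
  apply H2.
  - apply H1; eapply Rlt_le_trans; [exact u_near|apply Rmin_l].
  - eapply Rlt_le_trans; [exact u_near|apply Rmin_r].
Qed.

Definition continuous_on_set (D : R -> Prop) (f : R -> R) : Prop :=
  forall t, D t -> filterlim f (within D (locally t)) (locally (f t)).

Lemma derivative_on_continuous (D : R -> Prop) (f f' : R -> R) :
  derivative_on D f f' -> continuous_on_set D f.
Proof. intros df t Dt; exact (is_derive_within_continuous D f t _ (df t Dt)). Qed.

(** * Calculus on an interval *)

(** Nearest-point projection onto [[a, b]]. Composing with it turns a function continuous relative
    to an interval into one continuous on all of [R], to which integrability and the mean value
    theorem apply. *)
Definition clamp (a b u : R) : R := Rmax a (Rmin b u).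

Lemma clamp_between (a b u : R) : a <= b -> a <= clamp a b u <= b.
Proof.
  intros ab; unfold clamp; split; [apply Rmax_l|].
  apply Rmax_lub; [exact ab|apply Rmin_l].
Qed.

Lemma clamp_id (a b u : R) : a <= u <= b -> clamp a b u = u.
Proof. intros [au ub]; unfold clamp; rewrite Rmin_right, Rmax_right; lra. Qed.

Lemma clamp_contract (a b u v : R) : Rabs (clamp a b u - clamp a b v) <= Rabs (u - v).
Proof.
  unfold clamp, Rmax, Rmin.
  repeat destruct Rle_dec; unfold Rabs; repeat destruct Rcase_abs; lra.
Qed.

Lemma continuous_clamp (D : R -> Prop) (f : R -> R) (a b u : R) :
  a <= b -> (forall v, a <= v <= b -> D v) -> continuous_on_set D f ->
  continuous (fun v => f (clamp a b v)) u.
Proof.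
  intros ab subD fC P HP.
  destruct (fC (clamp a b u) (subD _ (clamp_between a b u ab)) P HP) as [delta Hdelta].
  exists delta; intros v v_near.
  apply Hdelta.
  - apply Rle_lt_trans with (2 := v_near); apply clamp_contract.
  - apply subD, clamp_between, ab.
Qed.

Section Interval.
Context (I : R -> Prop) (I_interval : is_interval I).

Lemma interval_between (a b c : R) : I a -> I b -> Rmin a b <= c <= Rmax a b -> I c.
Proof.
  intros Ia Ib; apply (proj1 I_interval).
  - now apply Rmin_case.
  - now apply Rmax_case.
Qed.

Lemma interval_ex_RInt (f : R -> R) (a b : R) :
  continuous_on_set I f -> I a -> I b -> ex_RInt f a b.
Proof.
  intros fC Ia Ib.
  (* The integral only sees points strictly between [a] and [b], where clamping changes nothing. *)
  apply ex_RInt_ext with (fun u => f (clamp (Rmin a b) (Rmax a b) u)).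
  - intros u [au ub]; rewrite clamp_id; [reflexivity | lra].
  - apply (@ex_RInt_continuous R_CompleteNormedModule); intros u _.
    apply continuous_clamp with I; [apply Rminmax| |exact fC].
    intros v; now apply interval_between.
Qed.

(** The error term is the integral of [f v - f t] between [t] and [u]. All such [v] stay in [I] and
    are no farther from [t] than [u], so relative continuity bounds the integrand by [eps]. *)
Lemma RInt_derivative_on (f : R -> R) (a : R) :
  continuous_on_set I f -> I a -> derivative_on I (fun t => RInt f a t) f.
Proof.
  intros fC Ia t It; apply is_derive_withinP; [exact It|]; intros eps.
  destruct (fC t It (ball (f t) eps) (locally_ball (f t) eps)) as [delta Hdelta].
  exists delta; intros u Iu u_near.
  replace (RInt f a u - RInt f a t - (u - t) * f t)
    with (RInt f t u - (u - t) * f t).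
  2: { rewrite <- (RInt_Chasles f a t u); try now apply interval_ex_RInt.
       unfold plus; simpl; ring. }
  rewrite (Rmult_comm eps).
  apply (norm_RInt_le_const_abs (V := R_NormedModule) (fun v => minus (f v) (f t)) t u).
  - intros v Hv.
    apply Rlt_le; apply (Hdelta v); [|now apply interval_between with t u].
    apply Rle_lt_trans with (2 := u_near).
    change (Rabs (v - t) <= Rabs (u - t)).
    revert Hv; unfold Rmin, Rmax, Rabs; destruct Rle_dec;
      repeat destruct Rcase_abs; lra.
  - apply (is_RInt_minus (V := R_NormedModule) f (fun _ => f t)).
    + apply (RInt_correct (V := R_CompleteNormedModule)); now apply interval_ex_RInt.
    + apply (is_RInt_const (V := R_NormedModule)).
Qed.

(** Mean value theorem for the clamped [f]: strictly between [a] and [b] the relative derivative is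
    two-sided, and at the two ends continuity suffices. *)
Lemma zero_derivative_on_const (f : R -> R) (a b : R) :
  derivative_on I f (fun _ => 0) -> I a -> I b -> f a = f b.
Proof.
  intros df Ia Ib.
  assert (fC := derivative_on_continuous I f _ df).
  set (m := Rmin a b); set (M := Rmax a b).
  assert (mM : m <= M) by apply Rminmax.
  assert (sub : forall v, m <= v <= M -> I v)
    by (intros v; now apply interval_between).
  set (g := fun u => f (clamp m M u)).
  destruct (MVT_gen g a b (fun _ => 0)) as [c [_ Hc]].
  - intros u Hu; fold m M in Hu.
    assert (u_near : locally u (fun v => m < v < M)).
    { apply locally_interval with m M; [exact (proj1 Hu)|exact (proj2 Hu)|].
      intros v mv vM; exact (conj mv vM). }
    apply is_derive_ext_loc with f.
    + apply filter_imp with (2 := u_near); intros v Hv.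
      unfold g; rewrite clamp_id; [reflexivity | lra].
    + apply is_derive_within_locally with I.
      * apply filter_imp with (2 := u_near); intros v Hv; apply sub; lra.
      * apply df, sub; lra.
  - intros u _; apply continuity_pt_filterlim.
    now apply continuous_clamp with I.
  - unfold g in Hc; rewrite !clamp_id in Hc.
    + lra.
    + split; [apply Rmin_l | apply Rmax_l].
    + split; [apply Rmin_r | apply Rmax_r].
Qed.

(** An interval with more than one point has points [u <> t] arbitrarily close to [t]; comparing
    both linear approximations there gives [Rabs (d1 - d2) <= 2 * eps]. *)
Lemma is_derive_within_unique (f : R -> R) (t d1 d2 : R) :
  I t -> is_derive_within I f t d1 -> is_derive_within I f t d2 -> d1 = d2.
Proof.
  intros It D1 D2.
  assert (close : forall eps : posreal, exists u, u <> t /\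
            Rabs (f u - f t - (u - t) * d1) <= eps * Rabs (u - t) /\
            Rabs (f u - f t - (u - t) * d2) <= eps * Rabs (u - t)).
  { intros eps.
    destruct (proj1 (is_derive_withinP I f t d1 It) D1 eps) as [[e1 p1] H1].
    destruct (proj1 (is_derive_withinP I f t d2 It) D2 eps) as [[e2 p2] H2].
    simpl in H1, H2.
    set (e := Rmin e1 e2 / 2).
    assert (He : 0 < e /\ e < e1 /\ e < e2)
      by (unfold e, Rmin; destruct Rle_dec; lra).
    destruct I_interval as [conv [a [b [Ia [Ib ab]]]]].
    assert (ex_u : exists u, I u /\ u <> t /\ Rabs (u - t) <= e).
    (* Step towards [b] if [t < b]; otherwise [a < b <= t] leaves room on the left. *)
    { destruct (Rlt_dec t b) as [tb|bt].
      - exists (Rmin b (t + e)); split; [|split].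
        + apply conv with t b; [exact It|exact Ib|].
          unfold Rmin; destruct Rle_dec; lra.
        + unfold Rmin; destruct Rle_dec; lra.
        + unfold Rmin, Rabs; destruct Rle_dec; destruct Rcase_abs; lra.
      - exists (Rmax a (t - e)); split; [|split].
        + apply conv with a t; [exact Ia|exact It|].
          unfold Rmax; destruct Rle_dec; lra.
        + unfold Rmax; destruct Rle_dec; lra.
        + unfold Rmax, Rabs; destruct Rle_dec; destruct Rcase_abs; lra. }
    destruct ex_u as [u [Iu [ut near]]].
    exists u; split; [exact ut|split; [apply H1|apply H2]]; try exact Iu; lra. }
  destruct (Req_dec d1 d2) as [|ne]; [assumption|exfalso].
  (* With [eps] a quarter of the gap, the two errors add up to at most half of it, a
     contradiction. *)
  assert (pos : 0 < Rabs (d1 - d2) / 4)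
    by (pose proof (Rabs_pos_lt (d1 - d2)); lra).
  destruct (close (mkposreal _ pos)) as [u [ut [H1 H2]]]; simpl in H1, H2.
  assert (up : 0 < Rabs (u - t)) by (apply Rabs_pos_lt; lra).
  assert (H : Rabs ((u - t) * (d1 - d2)) <= Rabs (d1 - d2) / 2 * Rabs (u - t)).
  { replace ((u - t) * (d1 - d2)) with
      ((f u - f t - (u - t) * d2) + - (f u - f t - (u - t) * d1)) by ring.
    eapply Rle_trans; [apply Rabs_triang|]; rewrite Rabs_Ropp; lra. }
  rewrite Rabs_mult in H; nra.
Qed.

End Interval.

(** * A class of smooth functions *)

(* Every member has a derivative on [D] that is again a member, which makes all
   members C^infinity without Leibniz or Faa di Bruno formulas; primitives are
   members so that a function defined by an integral, or only known through its
   derivative, is covered. *)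
Inductive elementary (D : R -> Prop) : (R -> R) -> Prop :=
| elementary_smooth f : smooth_on D f -> elementary D f
| elementary_primitive f g : derivative_on D f g -> elementary D g -> elementary D f
| elementary_plus f g :
    elementary D f -> elementary D g -> elementary D (fun u => f u + g u)
| elementary_mult f g :
    elementary D f -> elementary D g -> elementary D (fun u => f u * g u)
| elementary_opp f : elementary D f -> elementary D (fun u => - f u)
| elementary_inv f :
    (forall t, D t -> f t <> 0) -> elementary D f -> elementary D (fun u => / f u)
| elementary_sin f : elementary D f -> elementary D (fun u => sin (f u))
| elementary_cos f : elementary D f -> elementary D (fun u => cos (f u)).

Lemma smooth_on_derivative (D : R -> Prop) (f : R -> R) :
  smooth_on D f -> exists g, derivative_on D f g /\ smooth_on D g.
Proof.
  intros [fn [f0 fS]]; exists (fn 1%nat); split.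
  - intros t Dt; apply is_derive_within_ext with (fn 0%nat); [exact Dt|exact f0|].
    now apply fS.
  - exists (fun n => fn (S n)); split; [reflexivity|intros n; apply fS].
Qed.

Lemma elementary_derivative (D : R -> Prop) (f : R -> R) :
  elementary D f -> exists g, derivative_on D f g /\ elementary D g.
Proof.
  induction 1 as [f Hf | f g df Hg _ | f g Hf [f' [df Hf']] Hg [g' [dg Hg']]
    | f g Hf [f' [df Hf']] Hg [g' [dg Hg']] | f Hf [f' [df Hf']]
    | f nz Hf [f' [df Hf']] | f Hf [f' [df Hf']] | f Hf [f' [df Hf']]].
  - destruct (smooth_on_derivative D f Hf) as [g [dg Hg]].
    exists g; split; [exact dg | now apply elementary_smooth].
  - now exists g.
  - exists (fun u => f' u + g' u); split; [|now apply elementary_plus].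
    intros t Dt; exact (is_derive_within_plus D f g t _ _ (df t Dt) (dg t Dt)).
  - exists (fun u => f' u * g u + f u * g' u); split.
    + intros t Dt; apply is_derive_within_mult; auto.
    + apply elementary_plus; now apply elementary_mult.
  - exists (fun u => - f' u); split; [|now apply elementary_opp].
    intros t Dt; apply is_derive_within_opp; auto.
  (* The square of the inverse is written as a product, so that the constructors of the class apply
     to it. *)
  - exists (fun u => f' u * - (/ f u * / f u)); split.
    + intros t Dt; apply (is_derive_within_comp D f Rinv); auto.
      auto_derive; [auto | field; auto].
    + apply elementary_mult; [assumption|]; apply elementary_opp.
      apply elementary_mult; now apply elementary_inv.
  - exists (fun u => f' u * cos (f u)); split.
    + intros t Dt; apply is_derive_within_sin; auto.
    + apply elementary_mult; [assumption|now apply elementary_cos].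
  - exists (fun u => f' u * - sin (f u)); split.
    + intros t Dt; apply is_derive_within_cos; auto.
    + apply elementary_mult; [assumption|now apply elementary_opp, elementary_sin].
Qed.

(** Choosing a derivative within the class and iterating the choice gives the whole sequence of
    derivatives; the sigma type carries the membership proof that the next choice needs. *)
Lemma elementary_smooth_on (D : R -> Prop) (f : R -> R) :
  elementary D f -> smooth_on D f.
Proof.
  intros Hf.
  set (next := fun h : {g | elementary D g} =>
    let E := constructive_indefinite_description _
               (elementary_derivative D _ (proj2_sig h)) in
    exist (elementary D) (proj1_sig E) (proj2 (proj2_sig E))).
  exists (fun n => proj1_sig (Nat.iter n next (exist _ f Hf))); split.
  - reflexivity.
  - intros n; exact (proj1 (proj2_sig (constructive_indefinite_description _
      (elementary_derivative D _ (proj2_sig (Nat.iter n next (exist _ f Hf))))))).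
Qed.

Lemma elementary_continuous (D : R -> Prop) (f : R -> R) :
  elementary D f -> continuous_on_set D f.
Proof.
  intros Hf; destruct (elementary_derivative D f Hf) as [g [dg _]].
  exact (derivative_on_continuous D f g dg).
Qed.

Lemma elementary_minus (D : R -> Prop) (f g : R -> R) :
  elementary D f -> elementary D g -> elementary D (fun u => f u - g u).
Proof.
  intros Hf Hg; apply (elementary_plus D f (fun u => - g u)); [exact Hf|].
  now apply elementary_opp.
Qed.

Lemma elementary_const (D : R -> Prop) (a : R) : elementary D (fun _ => a).
Proof.
  apply elementary_smooth.
  exists (fun n => match n with O => fun _ => a | S _ => fun _ => 0 end); split.
  - reflexivity.
  - intros [|n] t _; apply is_derive_within_const.
Qed.

(** * Polar angle of a curve *)

(** [acos c] has the right cosine and a nonnegative sine; the sign of [s] decides whether to negate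
    it. *)
Lemma unit_circle_angle (c s : R) : c ^ 2 + s ^ 2 = 1 -> exists a, c = cos a /\ s = sin a.
Proof.
  intros E.
  assert (bound : -1 <= c <= 1) by nra.
  assert (root : sqrt (1 - Rsqr c) = Rabs s).
  { rewrite <- sqrt_Rsqr_abs; f_equal; unfold Rsqr; lra. }
  destruct (Rle_dec 0 s) as [s0|s0].
  - exists (acos c); rewrite cos_acos, sin_acos, root, Rabs_right; auto; lra.
  - exists (- acos c); rewrite cos_neg, sin_neg, cos_acos, sin_acos, root, Rabs_left;
      auto; lra.
Qed.

(* The angle is the integral of the angular velocity; that it lifts [(A, B) / y]
   holds because the scalar and cross products of [(A, B) / y] with
   [(cos psi, sin psi)] have zero derivative. *)
Lemma polar_angle_lifting (I : R -> Prop) (t0 : R) (A B A' B' y : R -> R) :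
  is_interval I -> I t0 ->
  derivative_on I A A' -> derivative_on I B B' ->
  derivative_on I y (fun t => (A t * A' t + B t * B' t) / y t) ->
  (forall t, I t -> 0 < y t) -> (forall t, I t -> y t ^ 2 = A t ^ 2 + B t ^ 2) ->
  continuous_on_set I (fun t => (A t * B' t - B t * A' t) / y t ^ 2) ->
  exists psi : R -> R,
    derivative_on I psi (fun t => (A t * B' t - B t * A' t) / y t ^ 2) /\
    forall t, I t -> A t = y t * cos (psi t) /\ B t = y t * sin (psi t).
Proof.
  intros I_interval I_t0 dA dB dy ypos y2 rhoC.
  set (rho := fun t => (A t * B' t - B t * A' t) / y t ^ 2) in *.
  assert (yn : forall t, I t -> y t <> 0)
    by (intros t It; apply not_eq_sym, Rlt_not_eq; auto).
  (* The initial angle [a] makes the scalar product 1 and the cross product 0 at [t0]. *)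
  destruct (unit_circle_angle (A t0 / y t0) (B t0 / y t0)) as [a [ca sa]].
  { transitivity ((A t0 ^ 2 + B t0 ^ 2) / y t0 ^ 2); [field; auto|].
    rewrite <- y2 by assumption; field; auto. }
  set (psi := fun t => a + RInt rho t0 t).
  assert (dpsi : derivative_on I psi rho).
  { intros t It; apply is_derive_within_eq with (0 + rho t); [ring|].
    apply (is_derive_within_plus I (fun _ => a)).
    - apply is_derive_within_const.
    - now apply RInt_derivative_on. }
  assert (psi0 : psi t0 = a).
  { unfold psi; rewrite RInt_point; unfold zero; simpl; ring. }
  assert (scalar : forall t, I t ->
            (A t * cos (psi t) + B t * sin (psi t)) / y t = 1).
  { intros t It.
    transitivity ((A t0 * cos (psi t0) + B t0 * sin (psi t0)) / y t0).
    - apply (zero_derivative_on_const I I_interval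
               (fun t => (A t * cos (psi t) + B t * sin (psi t)) / y t)); auto.
      intros u Iu; eapply is_derive_within_eq.
      2: { apply is_derive_within_div; [auto|auto| |auto].
           apply (is_derive_within_plus I (fun t => A t * cos (psi t))).
           - apply is_derive_within_mult; auto; apply is_derive_within_cos; auto.
           - apply is_derive_within_mult; auto; apply is_derive_within_sin; auto. }
      unfold rho.
      (* In this form [y u ^ 2] can be replaced by [A u ^ 2 + B u ^ 2], after which the numerator
         cancels identically. *)
      transitivity (((A' u * cos (psi u) + B' u * sin (psi u)) * y u ^ 2
          + (B u * cos (psi u) - A u * sin (psi u)) * (A u * B' u - B u * A' u)
          - (A u * cos (psi u) + B u * sin (psi u)) * (A u * A' u + B u * B' u))
          / y u ^ 3); [field; auto|].
      rewrite y2 by assumption; field; auto.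
    - rewrite psi0.
      transitivity (A t0 / y t0 * cos a + B t0 / y t0 * sin a); [field; auto|].
      rewrite ca, sa, Rplus_comm; apply sin2_cos2. }
  assert (cross : forall t, I t ->
            (A t * sin (psi t) - B t * cos (psi t)) / y t = 0).
  { intros t It.
    transitivity ((A t0 * sin (psi t0) - B t0 * cos (psi t0)) / y t0).
    - apply (zero_derivative_on_const I I_interval
               (fun t => (A t * sin (psi t) - B t * cos (psi t)) / y t)); auto.
      intros u Iu; eapply is_derive_within_eq.
      2: { apply is_derive_within_div; [auto|auto| |auto].
           apply is_derive_within_minus; [auto| |].
           - apply is_derive_within_mult; auto; apply is_derive_within_sin; auto.
           - apply is_derive_within_mult; auto; apply is_derive_within_cos; auto. }
      unfold rho.
      transitivity (((A' u * sin (psi u) - B' u * cos (psi u)) * y u ^ 2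
          + (A u * cos (psi u) + B u * sin (psi u)) * (A u * B' u - B u * A' u)
          - (A u * sin (psi u) - B u * cos (psi u)) * (A u * A' u + B u * B' u))
          / y u ^ 3); [field; auto|].
      rewrite y2 by assumption; field; auto.
    - rewrite psi0.
      transitivity (A t0 / y t0 * sin a - B t0 / y t0 * cos a); [field; auto|].
      rewrite ca, sa; ring. }
  exists psi; split; [exact dpsi|]; intros t It.
  assert (cs : sin (psi t) ^ 2 + cos (psi t) ^ 2 = 1)
    by (rewrite <- !Rsqr_pow2; apply sin2_cos2).
  assert (S : A t * cos (psi t) + B t * sin (psi t) = y t).
  { rewrite <- (Rmult_1_r (y t)), <- (scalar t It); field; auto. }
  assert (C : A t * sin (psi t) - B t * cos (psi t) = 0).
  { rewrite <- (Rmult_0_r (y t)), <- (cross t It); field; auto. }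
  (* Rotating back by [psi t] recovers [A t] and [B t] from the scalar and cross products. *)
  split.
  - transitivity ((A t * cos (psi t) + B t * sin (psi t)) * cos (psi t)
                  + (A t * sin (psi t) - B t * cos (psi t)) * sin (psi t)).
    + transitivity (A t * (sin (psi t) ^ 2 + cos (psi t) ^ 2)); [rewrite cs; ring|ring].
    + rewrite S, C; ring.
  - transitivity ((A t * cos (psi t) + B t * sin (psi t)) * sin (psi t)
                  - (A t * sin (psi t) - B t * cos (psi t)) * cos (psi t)).
    + transitivity (B t * (sin (psi t) ^ 2 + cos (psi t) ^ 2)); [rewrite cs; ring|ring].
    + rewrite S, C; ring.
Qed.

(** * Surfaces of revolution *)

Lemma triple_eq (a b c a' b' c' : R) :
  a = a' -> b = b' -> c = c' -> (a, b, c) = (a', b', c').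
Proof. now intros -> -> ->. Qed.

(** A triple is the sum of its coordinates times the fixed basis vectors, so linearity of
    differentiation suffices. *)
Lemma filterdiff_triple (K : (R -> Prop) -> Prop) (FK : Filter K)
    (f g h : R -> R) (df dg dh : R) :
  filterdiff f K (fun k => scal k df) -> filterdiff g K (fun k => scal k dg) ->
  filterdiff h K (fun k => scal k dh) ->
  filterdiff (fun u => (f u, g u, h u)) K (fun k => scal k (df, dg, dh)).
Proof.
  intros Df Dg Dh.
  set (V := prod_NormedModule R_AbsRing
              (prod_NormedModule R_AbsRing R_NormedModule R_NormedModule) R_NormedModule).
  assert (axis : forall (f0 : R -> R) (df0 : R) (e : V),
            filterdiff f0 K (fun k => scal k df0) ->
            filterdiff (V := V) (fun u => scal (f0 u) e) K (fun k => scal (scal k df0) e)).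
  { intros f0 df0 e Df0; exact (filterdiff_scal_l_fct e f0 _ Df0). }
  assert (D := filterdiff_plus_fct _ _ _ _
    (filterdiff_plus_fct _ _ _ _ (axis f df (1, 0, 0) Df) (axis g dg (0, 1, 0) Dg))
    (axis h dh (0, 0, 1) Dh)).
  eapply filterdiff_ext; [|eapply filterdiff_ext_lin; [exact D|]].
  - intros u; simple refine (triple_eq _ _ _ _ _ _ _ _ _);
      cbv -[Rplus Rmult R0 R1 IZR]; ring.
  - intros k; simple refine (triple_eq _ _ _ _ _ _ _ _ _);
      cbv -[Rplus Rmult R0 R1 IZR]; ring.
Qed.

Lemma revolution_mean_curvature
    (I : R -> Prop) (x y phi : R -> R) (t theta l x' y' phi' : R) :
  I t -> is_derive_within I x t x' -> is_derive_within I y t y' ->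
  is_derive_within I phi t phi' -> l <> 0 -> 0 < y t ->
  x' = l * cos (phi t) -> y' = l * sin (phi t) ->
  is_mean_curvature I (revolution_surface x y) (revolution_normal phi) t theta
    (/ 2 * (cos (phi t) / y t - phi' / l)).
Proof.
  intros It dx dy dphi ln ypos Ex Ey.
  assert (yn : y t <> 0) by lra.
  assert (pt := sin2_cos2 (phi t)); assert (th := sin2_cos2 theta).
  unfold Rsqr in pt, th.
  assert (dsin := is_derive_within_sin I phi t phi' It dphi).
  assert (dcos := is_derive_within_opp _ _ _ _ It
                    (is_derive_within_cos I phi t phi' It dphi)).
  assert (scale : forall (h : R -> R) (dh a : R), is_derive_within I h t dh ->
            is_derive_within I (fun u => h u * a) t (dh * a)).
  { intros h dh a Dh; apply is_derive_within_eq with (dh * a + h t * 0); [ring|].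
    apply is_derive_within_mult; [exact It|exact Dh|apply is_derive_within_const]. }
  exists (x', y' * cos theta, y' * sin theta).
  exists (0, y t * - sin theta, y t * cos theta).
  exists (phi' * cos (phi t), - (phi' * - sin (phi t)) * cos theta,
          - (phi' * - sin (phi t)) * sin theta).
  exists (0, - cos (phi t) * - sin theta, - cos (phi t) * cos theta).
  assert (filter_I := within_filter R I (locally t) _).
  (* For fixed [t], both the surface and its normal have this form in [theta]. *)
  assert (rotation : forall a b : R,
    is_derive (fun w => (a, b * cos w, b * sin w)) theta
      (0, b * - sin theta, b * cos theta)).
  { intros a b; apply (filterdiff_triple (locally theta) _ (fun _ => a)).
    - exact (is_derive_const a theta).
    - assert (is_derive (fun w => b * cos w) theta (b * - sin theta)) as D
        by (auto_derive; [trivial|ring]); exact D.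
    - assert (is_derive (fun w => b * sin w) theta (b * cos theta)) as D
        by (auto_derive; [trivial|ring]); exact D. }
  refine (conj _ (conj _ (conj _ (conj _ (conj _ (conj _ (conj _ (conj _ _)))))))).
  - exact (filterdiff_triple _ filter_I x (fun u => y u * cos theta)
             (fun u => y u * sin theta) _ _ _ dx (scale y _ _ dy) (scale y _ _ dy)).
  - apply rotation.
  - exact (filterdiff_triple _ filter_I _ (fun u => - cos (phi u) * cos theta)
             (fun u => - cos (phi u) * sin theta) _ _ _ dsin
             (scale (fun u => - cos (phi u)) _ _ dcos)
             (scale (fun u => - cos (phi u)) _ _ dcos)).
  - apply rotation.
  - intros a b E.
    change ((a * x' + b * 0, a * (y' * cos theta) + b * (y t * - sin theta),
             a * (y' * sin theta) + b * (y t * cos theta)) = (0, 0, 0)) in E.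
    injection E as E1 E2 E3; rewrite Ex in E1; rewrite Ey in E2, E3.
    (* Pair the relation with [(0, - sin theta, cos theta)], the unit direction of [s_theta], which
       is orthogonal to [s_t]. *)
    assert (Eb : b * y t = 0).
    { transitivity (b * y t * (sin theta * sin theta + cos theta * cos theta));
        [rewrite th; ring|].
      transitivity
        ((a * (l * sin (phi t) * sin theta) + b * (y t * cos theta)) * cos theta
         - (a * (l * sin (phi t) * cos theta) + b * (y t * - sin theta)) * sin theta);
        [ring|rewrite E2, E3; ring]. }
    (* Pair it with [(cos phi, sin phi cos theta, sin phi sin theta)]: the vector [s_t] is [l] times
       this unit vector, and [s_theta] is orthogonal to it. *)
    assert (Ea : a * l = 0).
    { transitivity (a * l * (sin (phi t) * sin (phi t) *
          (sin theta * sin theta + cos theta * cos theta) + cos (phi t) * cos (phi t)));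
        [rewrite th, Rmult_1_r, pt; ring|].
      transitivity
        ((a * (l * cos (phi t)) + b * 0) * cos (phi t)
         + (a * (l * sin (phi t) * cos theta) + b * (y t * - sin theta))
           * (sin (phi t) * cos theta)
         + (a * (l * sin (phi t) * sin theta) + b * (y t * cos theta))
           * (sin (phi t) * sin theta));
        [ring|rewrite E1, E2, E3; ring]. }
    split.
    + destruct (Rmult_integral _ _ Ea); [assumption|contradiction].
    + destruct (Rmult_integral _ _ Eb); [assumption|contradiction].
  - simpl.
    transitivity (sin (phi t) * sin (phi t) + cos (phi t) * cos (phi t)
                  * (sin theta * sin theta + cos theta * cos theta)); [ring|].
    rewrite th, Rmult_1_r; exact pt.
  - simpl; rewrite Ex, Ey.
    transitivity (l * sin (phi t) * cos (phi t)
                  * (1 - (sin theta * sin theta + cos theta * cos theta))); [ring|].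
    rewrite th; ring.
  - simpl; ring.
  (* Here [nu_t = (phi' / l) s_t] and [nu_theta = - (cos phi / y) s_theta], so the shape operator is
     diagonal in this basis. *)
  - exists (- (phi' / l)), 0, 0, (cos (phi t) / y t); repeat apply conj.
    + simple refine (triple_eq _ _ _ _ _ _ _ _ _);
        cbv -[Rplus Rmult Ropp Rdiv IZR sin cos]; rewrite ?Ex, ?Ey; field; assumption.
    + simple refine (triple_eq _ _ _ _ _ _ _ _ _);
        cbv -[Rplus Rmult Ropp Rdiv IZR sin cos]; rewrite ?Ex, ?Ey; field; assumption.
    + field; split; assumption.
Qed.

(** * Curves of prescribed mean curvature *)

Section Kenmotsu.
Context (I : R -> Prop) (I_interval : is_interval I) (I_0 : I 0) (l Hl : R -> R).
Context (l_smooth : smooth_on I l) (Hl_smooth : smooth_on I Hl).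

(** Applied first to [eta] and then to [F] and [G], whose integrands contain [eta]. *)
Lemma elementary_RInt (f : R -> R) : elementary I f ->
  derivative_on I (fun t => RInt f 0 t) f /\ elementary I (fun t => RInt f 0 t).
Proof.
  intros Hf.
  assert (D : derivative_on I (fun t => RInt f 0 t) f)
    by (apply RInt_derivative_on; auto; now apply elementary_continuous).
  split; [exact D|now apply elementary_primitive with f].
Qed.

Let elementary_l : elementary I l.
Proof. now apply elementary_smooth. Qed.

Let elementary_2Hl : elementary I (fun t => 2 * Hl t).
Proof.
  apply (elementary_mult I (fun _ => 2)); [apply elementary_const|].
  now apply elementary_smooth.
Qed.

Lemma eta_derivative : derivative_on I (eta Hl) (fun t => 2 * Hl t).
Proof. exact (proj1 (elementary_RInt _ elementary_2Hl)). Qed.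

Lemma elementary_eta : elementary I (eta Hl).
Proof. exact (proj2 (elementary_RInt _ elementary_2Hl)). Qed.

Let elementary_F' : elementary I (fun t => l t * sin (eta Hl t)).
Proof.
  apply elementary_mult; [exact elementary_l|apply elementary_sin, elementary_eta].
Qed.

Let elementary_G' : elementary I (fun t => l t * cos (eta Hl t)).
Proof.
  apply elementary_mult; [exact elementary_l|apply elementary_cos, elementary_eta].
Qed.

Lemma F_derivative : derivative_on I (F l Hl) (fun t => l t * sin (eta Hl t)).
Proof. exact (proj1 (elementary_RInt _ elementary_F')). Qed.

Lemma elementary_F : elementary I (F l Hl).
Proof. exact (proj2 (elementary_RInt _ elementary_F')). Qed.

Lemma G_derivative : derivative_on I (G l Hl) (fun t => l t * cos (eta Hl t)).
Proof. exact (proj1 (elementary_RInt _ elementary_G')). Qed.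

Lemma elementary_G : elementary I (G l Hl).
Proof. exact (proj2 (elementary_RInt _ elementary_G')). Qed.

(** With [psi = phi + eta], the functions [y cos psi + F] and [G - y sin psi] have zero derivative;
    their constant values are [c1] and [c2]. *)
Lemma solution_given_by_formulas (x y phi : R -> R) :
  is_solution I l Hl x y phi ->
  exists c1 c2 : R, given_by_formulas I l Hl c1 c2 x y.
Proof.
  intros (_ & _ & _ & ypos & x' & y' & phi' & dx & dy & dphi & eqs).
  set (psi := fun t => phi t + eta Hl t).
  assert (dpsi : derivative_on I psi (fun t => phi' t + 2 * Hl t)).
  { intros t It; apply (is_derive_within_plus I phi); [auto|now apply eta_derivative]. }
  assert (psi_eq : forall t, I t -> y t * (phi' t + 2 * Hl t) = l t * cos (phi t)).
  { intros t It; destruct (eqs t It) as [E _]; lra. }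
  assert (phi_eq : forall t, phi t = psi t - eta Hl t) by (intros t; unfold psi; ring).
  assert (cos_phi : forall t, cos (phi t) =
            cos (psi t) * cos (eta Hl t) + sin (psi t) * sin (eta Hl t))
    by (intros t; rewrite phi_eq; apply cos_minus).
  assert (sin_phi : forall t, sin (phi t) =
            sin (psi t) * cos (eta Hl t) - cos (psi t) * sin (eta Hl t))
    by (intros t; rewrite phi_eq; apply sin_minus).
  assert (sp : forall t, sin (psi t) * sin (psi t) + cos (psi t) * cos (psi t) = 1)
    by (intros t; apply sin2_cos2).
  (* Both constants are read off at the base point 0, which lies in [I]. *)
  set (c1 := y 0 * cos (psi 0) + F l Hl 0).
  set (c2 := G l Hl 0 - y 0 * sin (psi 0)).
  assert (Fc : forall t, I t -> F l Hl t - c1 = - (y t * cos (psi t))).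
  { intros t It.
    enough (y t * cos (psi t) + F l Hl t = c1) by lra.
    apply (zero_derivative_on_const I I_interval (fun t => y t * cos (psi t) + F l Hl t));
      auto.
    intros u Iu; eapply is_derive_within_eq.
    2: { apply (is_derive_within_plus I (fun t => y t * cos (psi t))).
         - apply is_derive_within_mult; auto; apply is_derive_within_cos; auto.
         - now apply F_derivative. }
    destruct (eqs u Iu) as (_ & _ & ->).
    transitivity (l u * sin (phi u) * cos (psi u)
      - y u * (phi' u + 2 * Hl u) * sin (psi u) + l u * sin (eta Hl u)); [ring|].
    rewrite psi_eq, cos_phi, sin_phi by assumption.
    transitivity (l u * sin (eta Hl u)
      * (1 - (sin (psi u) * sin (psi u) + cos (psi u) * cos (psi u)))); [ring|].
    rewrite sp; ring. }
  assert (Gc : forall t, I t -> G l Hl t - c2 = y t * sin (psi t)).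
  { intros t It.
    enough (G l Hl t - y t * sin (psi t) = c2) by lra.
    apply (zero_derivative_on_const I I_interval (fun t => G l Hl t - y t * sin (psi t)));
      auto.
    intros u Iu; eapply is_derive_within_eq.
    2: { apply is_derive_within_minus; [exact Iu|now apply G_derivative|].
         apply is_derive_within_mult; auto; apply is_derive_within_sin; auto. }
    simpl; destruct (eqs u Iu) as (_ & _ & ->).
    transitivity (l u * cos (eta Hl u) - l u * sin (phi u) * sin (psi u)
      - y u * (phi' u + 2 * Hl u) * cos (psi u)); [ring|].
    rewrite psi_eq, cos_phi, sin_phi by assumption.
    transitivity (l u * cos (eta Hl u)
      * (1 - (sin (psi u) * sin (psi u) + cos (psi u) * cos (psi u)))); [ring|].
    rewrite sp; ring. }
  assert (root : forall t, I t -> y t = sqrt (radicand l Hl c1 c2 t)).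
  { intros t It; unfold radicand; rewrite Fc, Gc by assumption.
    transitivity (sqrt (y t * y t)).
    - symmetry; apply sqrt_square, Rlt_le; auto.
    - f_equal; transitivity (y t * y t
        * (sin (psi t) * sin (psi t) + cos (psi t) * cos (psi t))); [rewrite sp|]; ring. }
  exists c1, c2; split; [exact root|].
  exists x', (fun t => l t * sin (eta Hl t)), (fun t => l t * cos (eta Hl t)).
  split; [exact dx|split; [exact F_derivative|split; [exact G_derivative|]]].
  intros t It; rewrite <- root, Fc, Gc by assumption.
  (* The numerator of the formula becomes [y l (sin eta sin psi + cos eta cos psi)], that is
     [y l cos phi]. *)
  destruct (eqs t It) as (_ & -> & _); rewrite cos_phi.
  field; apply not_eq_sym, Rlt_not_eq; auto.
Qed.

Lemma formulas_give_solution (c1 c2 : R) (x y : R -> R) :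
  (forall t, I t -> 0 < radicand l Hl c1 c2 t) ->
  given_by_formulas I l Hl c1 c2 x y ->
  exists phi : R -> R, is_solution I l Hl x y phi.
Proof.
  intros rpos (root & x' & F' & G' & dx & dF & dG & x'_eq).
  (* The formulas only speak of some derivatives of [F] and [G]; uniqueness on the interval
     identifies them with the integrands. *)
  assert (F'_eq : forall t, I t -> F' t = l t * sin (eta Hl t)).
  { intros t It; apply (is_derive_within_unique I I_interval (F l Hl) t); auto.
    now apply F_derivative. }
  assert (G'_eq : forall t, I t -> G' t = l t * cos (eta Hl t)).
  { intros t It; apply (is_derive_within_unique I I_interval (G l Hl) t); auto.
    now apply G_derivative. }
  (* Real and imaginary parts of the curve that is to equal [y e^(i psi)]. *)
  set (A := fun t => c1 - F l Hl t); set (B := fun t => G l Hl t - c2).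
  set (A' := fun t => - (l t * sin (eta Hl t))).
  set (B' := fun t => l t * cos (eta Hl t)).
  assert (ypos : forall t, I t -> 0 < y t).
  { intros t It; rewrite root by assumption; apply sqrt_lt_R0; auto. }
  assert (yn : forall t, I t -> y t <> 0)
    by (intros t It; apply not_eq_sym, Rlt_not_eq; auto).
  assert (y2r : forall t, I t -> y t ^ 2 = radicand l Hl c1 c2 t).
  { intros t It; rewrite root by assumption; apply pow2_sqrt, Rlt_le; auto. }
  assert (y2 : forall t, I t -> y t ^ 2 = A t ^ 2 + B t ^ 2).
  { intros t It; rewrite y2r by assumption; unfold radicand, A, B; ring. }
  assert (dA : derivative_on I A A').
  { intros t It; eapply is_derive_within_eq.
    2: { apply is_derive_within_minus; [exact It|apply is_derive_within_const|].
         now apply F_derivative. }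
    unfold A'; ring. }
  assert (dB : derivative_on I B B').
  { intros t It; eapply is_derive_within_eq.
    2: { apply is_derive_within_minus; [exact It|now apply G_derivative|].
         apply is_derive_within_const. }
    unfold B'; ring. }
  assert (dy : derivative_on I y (fun t => (A t * A' t + B t * B' t) / y t)).
  { intros t It.
    apply is_derive_within_ext with (fun u => sqrt (A u * A u + B u * B u)).
    - exact It.
    - intros u Iu; rewrite root by assumption; f_equal; unfold radicand, A, B; ring.
    - assert (yt : y t = sqrt (A t * A t + B t * B t)).
      { rewrite root by assumption; f_equal; unfold radicand, A, B; ring. }
      eapply is_derive_within_eq.
      2: { apply is_derive_within_sqrt; [exact It| |].
           - replace (A t * A t + B t * B t) with (y t ^ 2)
               by (rewrite y2 by assumption; ring).
             apply pow_lt; auto.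
           - apply (is_derive_within_plus I (fun u => A u * A u)).
             + apply is_derive_within_mult; auto.
             + apply is_derive_within_mult; auto. }
      cbv beta; rewrite <- yt; field; auto. }
  assert (elA : elementary I A)
    by (apply elementary_minus; [apply elementary_const|apply elementary_F]).
  assert (elB : elementary I B)
    by (apply elementary_minus; [apply elementary_G|apply elementary_const]).
  assert (elA' : elementary I A') by (apply elementary_opp, elementary_F').
  (* The angular velocity is written with [A * A + B * B] in place of [y ^ 2]: smoothness of [y] is
     not yet established here, whereas [A] and [B] are in the class. *)
  assert (rhoE : elementary I
            (fun t => (A t * B' t - B t * A' t) * / (A t * A t + B t * B t))).
  { apply elementary_mult.
    - apply elementary_minus; apply elementary_mult; auto.
    - apply elementary_inv.
      + intros t It; replace (A t * A t + B t * B t) with (y t ^ 2)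
          by (rewrite y2 by assumption; ring).
        apply pow_nonzero; auto.
      + apply elementary_plus; apply elementary_mult; auto. }
  assert (rho_eq : forall t, I t ->
    (A t * B' t - B t * A' t) * / (A t * A t + B t * B t)
    = (A t * B' t - B t * A' t) / y t ^ 2).
  { intros t It; unfold Rdiv; do 2 f_equal; rewrite y2 by assumption; ring. }
  destruct (polar_angle_lifting I 0 A B A' B' y) as [psi [dpsi polar]]; auto.
  { intros t It; rewrite <- rho_eq by assumption.
    apply filterlim_within_ext with (2 := elementary_continuous _ _ rhoE t It).
    exact rho_eq. }
  set (phi := fun t => psi t - eta Hl t).
  assert (cos_phi : forall t, cos (phi t) =
            cos (psi t) * cos (eta Hl t) + sin (psi t) * sin (eta Hl t))
    by (intros t; apply cos_minus).
  assert (sin_phi : forall t, sin (phi t) =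
            sin (psi t) * cos (eta Hl t) - cos (psi t) * sin (eta Hl t))
    by (intros t; apply sin_minus).
  assert (elpsi : elementary I psi).
  { apply elementary_primitive with (2 := rhoE).
    intros t It; rewrite rho_eq by assumption; now apply dpsi. }
  assert (elphi : elementary I phi)
    by (apply elementary_minus; [exact elpsi|apply elementary_eta]).
  assert (dx_phi : derivative_on I x (fun t => l t * cos (phi t))).
  { intros t It; eapply is_derive_within_eq; [|exact (dx t It)].
    rewrite x'_eq, <- root, F'_eq, G'_eq by assumption.
    replace (F l Hl t - c1) with (- A t) by (unfold A; ring).
    fold (B t); destruct (polar t It) as [-> ->]; rewrite cos_phi; field; auto. }
  assert (dy_phi : derivative_on I y (fun t => l t * sin (phi t))).
  { intros t It; eapply is_derive_within_eq; [|exact (dy t It)]; simpl.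
    destruct (polar t It) as [-> ->]; rewrite sin_phi; unfold A', B'; field; auto. }
  exists phi; split; [|split; [|split; [|split]]].
  (* [x] and [y] are smooth as primitives of [l cos phi] and [l sin phi]. *)
  - apply elementary_smooth_on, elementary_primitive with (1 := dx_phi).
    apply elementary_mult; [exact elementary_l|now apply elementary_cos].
  - apply elementary_smooth_on, elementary_primitive with (1 := dy_phi).
    apply elementary_mult; [exact elementary_l|now apply elementary_sin].
  - now apply elementary_smooth_on.
  - exact ypos.
  - exists (fun t => l t * cos (phi t)), (fun t => l t * sin (phi t)),
      (fun t => (A t * B' t - B t * A' t) / y t ^ 2 - 2 * Hl t).
    split; [exact dx_phi|split; [exact dy_phi|split]].
    + intros t It; apply is_derive_within_minus; auto; now apply eta_derivative.
    + intros t It; split; [|split; reflexivity].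
      (* In polar form [A B' - B A' = y l cos phi], so [y phi' = l cos phi - 2 Hl y], the curvature
         equation. *)
      destruct (polar t It) as [-> ->]; rewrite cos_phi; unfold A', B'; field; auto.
Qed.

End Kenmotsu.

Theorem mainTheorem2
  (I : R -> Prop) (l H Hl : R -> R)
  (I_interval : is_interval I) (I_0 : I 0)
  (l_smooth : smooth_on I l)
  (P_discrete : is_discrete (fun t => I t /\ l t = 0))
  (H_smooth : smooth_on (fun t => I t /\ l t <> 0) H)
  (Hl_smooth : smooth_on I Hl)
  (Hl_extends : forall t, I t -> l t <> 0 -> Hl t = H t * l t) :
  (forall x y phi : R -> R,
     is_solution I l Hl x y phi ->
     exists c1 c2 : R, given_by_formulas I l Hl c1 c2 x y)
  /\
  (forall (c1 c2 : R) (x y : R -> R),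
     (forall t, I t -> 0 < (F l Hl t - c1) ^ 2 + (G l Hl t - c2) ^ 2) ->
     given_by_formulas I l Hl c1 c2 x y ->
     exists phi : R -> R,
       is_solution I l Hl x y phi /\
       forall t theta : R, I t -> l t <> 0 ->
         is_mean_curvature I (revolution_surface x y) (revolution_normal phi)
           t theta (H t)).
Proof.
  split; [intros x y phi; now apply solution_given_by_formulas|].
  intros c1 c2 x y rpos formulas.
  destruct (formulas_give_solution I I_interval I_0 l Hl l_smooth Hl_smooth c1 c2 x y
              rpos formulas) as [phi sol].
  exists phi; split; [exact sol|]; intros t theta It ln.
  destruct sol as (_ & _ & _ & ypos & x' & y' & phi' & dx & dy & dphi & eqs).
  destruct (eqs t It) as (curv & Ex & Ey); rewrite Hl_extends in curv by assumption.
  assert (yn : y t <> 0) by (apply not_eq_sym, Rlt_not_eq; auto).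
  replace (H t) with (/ 2 * (cos (phi t) / y t - phi' t / l t)).
  - now apply revolution_mean_curvature with (x' t) (y' t); auto.
  (* The difference of the two sides is the left side of the curvature equation divided by
     [- 2 l y], which is nonzero off [P]. *)
  - apply Rminus_diag_uniq.
    transitivity (- (2 * (H t * l t) * y t - l t * cos (phi t) + y t * phi' t)
                  / (2 * l t * y t)); [field; auto|].
    rewrite curv; field; auto.
Qed.
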